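(* There exist constants $c_4$ and $c_5$ such that for every constant $k$, the $(\mathcal{G}_{n,p}, \rho_k)$-quality control problem (estimating the number of $k$-cliques in a graph $G$ supposedly drawn from $\mathcal{G}_{n,p}$) can be solved in $O(n^{c_4})$ time provided $n \geq p^{-c_5 k}$.
   Context: Quality control: let $\mathcal{X}$ be a set, $\rho:\mathcal{X}\to\mathbb{R}_{\ge 0}$, $\varepsilon>0$ a fixed small constant, and $\mathcal{D}$ a distribution on $\mathcal{X}$ with $\Pr_{x\sim\mathcal{D}}[|\rho(x)-1|\le\varepsilon]\ge 9/10$. A (randomized) $(\mathcal{D},\rho)$-quality control algorithm $A$ must satisfy: (i) $\Pr_{x\sim\mathcal{D},R}[A(x)=\textsc{Accept}]\ge 2/3$, where $R$ is the algorithm's internal randomness; (ii) for every $x$ with $|\rho(x)-1|>\varepsilon$, $\Pr_R[A(x)=\textsc{Reject}]\ge 2/3$. Here inputs are graphs on vertex set $[n]$ (given to the algorithm, e.g. as an adjacency matrix). $\mathcal{G}_{n,p}$ is the Erdős–Rényi distribution. $C_k(G)$ denotes the number of (labeled) $k$-cliques of $G$, and $\rho_k(G) = C_k(G)/\mathbb{E}_{G'\sim\mathcal{G}_{n,p}}[C_k(G')]$. The accuracy $\varepsilon$ is treated as a constant. *)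

(* Defs.v *)
From HB Require Import structures.
From mathcomp Require Import all_boot all_order all_algebra.
From mathcomp Require Import reals exp.

Set Implicit Arguments.
Unset Strict Implicit.
Unset Printing Implicit Defensive.

Import Order.TTheory GRing.Theory Num.Theory.

Local Open Scope ring_scope.

Definition is_adjacency (n : nat) (M : 'M[bool]_n) : bool :=
  [forall i, ~~ M i i] && [forall i, forall j, M i j == M j i].

Record graph (n : nat) := Graph {
  adj :> 'M[bool]_n;
  _ : is_adjacency adj
}.

HB.instance Definition _ (n : nat) := [isSub for @adj n].
HB.instance Definition _ (n : nat) := [Finite of graph n by <:].

(* Probability mass function of the Erdos-Renyi distribution. *)
Definition gnp (R : realType) (n : nat) (p : R) (G : graph n) : R :=
  \prod_(i < n) \prod_(j < n | (i < j)%N) (if G i j then p else 1 - p).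

(* Labeled k-cliques are ordered k-tuples of pairwise adjacent vertices; they
   are automatically injective because adjacency is irreflexive. *)
Definition nb_cliques (n k : nat) (G : graph n) : nat :=
  #|[set t : {ffun 'I_k -> 'I_n} |
      [forall i, forall j, (i != j) ==> G (t i) (t j)]]|.

Definition expected_cliques (R : realType) (n k : nat) (p : R) : R :=
  \sum_(G : graph n) gnp p G * (nb_cliques k G)%:R.

Definition rho_clique (R : realType) (n k : nat) (p : R) (G : graph n) : R :=
  (nb_cliques k G)%:R / expected_cliques n k p.

Definition qc_admissible (R : realType) (X : finType) (D rho : X -> R)
    (eps : R) : Prop :=
  9%:R / 10%:R <= \sum_(x | `|rho x - 1| <= eps) D x.

(* Probability of E under the uniform distribution on T independent coins. *)
Definition coin_prob (R : realType) (T : nat) (E : pred (T.-tuple bool)) : R :=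
  #|[set r | E r]|%:R / 2%:R ^+ T.

(* [A x r] is the answer on input x with coins r: [Some true] is Accept,
   [Some false] is Reject, [None] is no answer. *)
Definition quality_control (R : realType) (X : finType) (D rho : X -> R)
    (eps : R) (T : nat) (A : X -> T.-tuple bool -> option bool) : Prop :=
  2%:R / 3%:R
    <= \sum_x D x * coin_prob R (fun r => A x r == Some true)
  /\ forall x, eps < `|rho x - 1| ->
       2%:R / 3%:R <= coin_prob R (fun r => A x r == Some false).

(* Model of computation: the probabilistic real RAM at unit cost. There are
   integer registers z_i, used for addressing and equipped with addition and
   truncated subtraction only (no unit-cost multiplication, division or
   shift), and real registers x_i with exact field arithmetic and comparison,
   but without rounding or any other conversion from reals to integers. Real
   registers are needed because p and eps are arbitrary real numbers. Programs
   contain no real constants. *)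
Inductive instr :=
| IConst of nat & nat             (* z_i := c *)
| IAdd of nat & nat & nat         (* z_i := z_j + z_l *)
| ISub of nat & nat & nat         (* z_i := z_j - z_l, truncated *)
| ILoad of nat & nat              (* z_i := z_(z_j) *)
| IStore of nat & nat             (* z_(z_i) := z_j *)
| IFlip of nat                    (* z_i := fair coin *)
| IAdj of nat & nat & nat         (* z_i := entry (z_j, z_l) of the input *)
| ROfInt of nat & nat             (* x_i := z_j *)
| RAdd of nat & nat & nat         (* x_i := x_j + x_l *)
| RSub of nat & nat & nat         (* x_i := x_j - x_l *)
| RMul of nat & nat & nat         (* x_i := x_j * x_l *)
| RDiv of nat & nat & nat         (* x_i := x_j / x_l *)
| RLoad of nat & nat              (* x_i := x_(z_j) *)
| RStore of nat & nat             (* x_(z_i) := x_j *)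
| Jump of nat                     (* goto m *)
| IJumpLe of nat & nat & nat      (* if z_i <= z_j goto m *)
| RJumpLe of nat & nat & nat      (* if x_i <= x_j goto m *)
| Halt of bool.                   (* stop; true = Accept, false = Reject *)

Definition program := seq instr.

Record config (R : realType) := Config {
  pc : nat;
  ireg : nat -> nat;
  rreg : nat -> R;
  answer : option bool
}.

Definition upd (V : Type) (f : nat -> V) (i : nat) (v : V) : nat -> V :=
  fun l => if l == i then v else f l.

(* Entries outside the n x n matrix read as false. *)
Definition adj_query (n : nat) (G : graph n) (a b : nat) : bool :=
  match insub a : option 'I_n, insub b : option 'I_n with
  | Some i, Some j => G i j
  | _, _ => false
  end.

Definition exec (R : realType) (n : nat) (G : graph n) (coin : bool)
    (c : config R) (ins : instr) : config R :=
  let z := ireg c in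
  let x := rreg c in
  let next := (pc c).+1 in
  let seti i v := Config next (upd z i v) x None in
  let setr i v := Config next z (upd x i v) None in
  let goto m := Config m z x None in
  match ins with
  | IConst i v => seti i v
  | IAdd i j l => seti i (z j + z l)%N
  | ISub i j l => seti i (z j - z l)%N
  | ILoad i j => seti i (z (z j))
  | IStore i j => seti (z i) (z j)
  | IFlip i => seti i (nat_of_bool coin)
  | IAdj i j l => seti i (nat_of_bool (adj_query G (z j) (z l)))
  | ROfInt i j => setr i (z j)%:R
  | RAdd i j l => setr i (x j + x l)
  | RSub i j l => setr i (x j - x l)
  | RMul i j l => setr i (x j * x l)
  | RDiv i j l => setr i (x j / x l)
  | RLoad i j => setr i (x (z j))
  | RStore i j => setr (z i) (x j)
  | Jump m => goto m
  | IJumpLe i j m => goto (if (z i <= z j)%N then m else next)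
  | RJumpLe i j m => goto (if x i <= x j then m else next)
  | Halt b => Config (pc c) z x (Some b)
  end.

(* A program counter outside the program leaves the machine stuck without an
   answer. *)
Definition step (R : realType) (P : program) (n : nat) (G : graph n)
    (c : config R) (coin : bool) : config R :=
  if answer c is Some _ then c
  else if onth P (pc c) is Some ins then exec G coin c ins else c.

(* Inputs: z_0 = n, x_0 = p, x_1 = eps, and the graph through [IAdj]. *)
Definition init (R : realType) (n : nat) (p eps : R) : config R :=
  Config 0 (upd (fun=> 0%N) 0 n) (upd (upd (fun=> 0) 0 p) 1 eps) None.

(* The answer after [size r] steps. Each step draws a fresh coin, which is
   ignored unless the instruction executed is [IFlip]. *)
Definition run (R : realType) (P : program) (n : nat) (p eps : R)
    (G : graph n) (r : seq bool) : option bool :=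
  answer (foldl (step P G) (init n p eps) r).

Definition halts_within (R : realType) (P : program) (n : nat) (p eps : R)
    (T : nat) : Prop :=
  forall (G : graph n) (r : T.-tuple bool), run P p eps G r != None.

(* Main.v *)
Require Import Defs.
From HB Require Import structures.
From mathcomp Require Import all_boot all_order all_algebra.
From mathcomp Require Import reals exp.
From mathcomp Require Import ring lra zify.
Import Order.TTheory GRing.Theory Num.Theory.
Local Open Scope ring_scope.

Set Implicit Arguments.
Unset Strict Implicit.
Unset Printing Implicit Defensive.

(** Let A be the adjacency matrix, J the all-ones matrix and M = A - pJ. The
    test accepts iff tr M^4 <= 18 n^3, which is computable in O(n^4) steps.
    Under G(n,p) a closed walk on four distinct vertices contributes 0 to
    E tr M^4, so E tr M^4 <= 6 n^3 and Markov's inequality gives acceptance with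
    probability at least 2/3.

    Conversely let N_k count the labeled k-cliques of a graph passing the test.
    Replacing the k edges from a new vertex to a k-clique by p, one at a time,
    and applying Cauchy-Schwarz to the bilinear form of M gives
    |N_(k+1) - n p^k N_k| <= k (tr M^4)^(1/4) (n N_(k-1) N_k)^(1/2).
    When n >= p^(-12k) the error is of lower order, so N_k is asymptotic to
    n^k p^C(k,2), hence to its expectation. This only leaves
    the finitely many n below a threshold depending on k and eps, where the
    k-cliques are counted exhaustively in constant time. *)

(** * Words of fixed length and sums over them *)

(** Lists can be cut at any position, as the hybrid argument needs, and the same enumeration later
    generates the code of the exhaustive count. *)
Fixpoint words (V : Type) (r : seq V) (k : nat) : seq (seq V) :=
  if k is k'.+1 then [seq x :: s | x <- r, s <- words r k'] else [:: [::]].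

Section Words.
Variables (R : realFieldType) (V : Type) (r : seq V).

Lemma sum_words0 (F : seq V -> R) : \sum_(s <- words r 0) F s = F [::].
Proof. by rewrite /= big_seq1. Qed.

Lemma sum_wordsS k (F : seq V -> R) :
  \sum_(s <- words r k.+1) F s = \sum_(x <- r) \sum_(s <- words r k) F (x :: s).
Proof. by rewrite /= big_allpairs_dep. Qed.

Lemma sum_words_cat a b (F : seq V -> R) :
  \sum_(s <- words r (a + b)) F s =
  \sum_(u <- words r a) \sum_(v <- words r b) F (u ++ v).
Proof.
elim: a F => [|a IH] F; first by rewrite sum_words0.
by rewrite addSn !sum_wordsS; apply: eq_bigr => x _; rewrite IH.
Qed.

End Words.

Lemma words_map (V W : Type) (f : V -> W) (r : seq V) k :
  words (map f r) k = map (map f) (words r k).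
Proof.
elim: k => //= k IH; rewrite IH allpairs_mapl allpairs_mapr map_allpairs //.
Qed.

Section WordsEq.
Variables (V : eqType) (r : seq V).

Lemma mem_words k s : (s \in words r k) = (size s == k) && all (mem r) s.
Proof.
elim: k s => [|k IH] s /=; first by case: s.
apply/allpairsP/idP => [[[x t] /= [xr]]|].
  by rewrite IH => /andP[/eqP<- rt] ->; rewrite /= eqxx xr.
case: s => //= x t; rewrite eqSS => /and3P[tk xr rt].
by exists (x, t); split=> //=; rewrite IH tk.
Qed.

Lemma words_uniq k : uniq r -> uniq (words r k).
Proof.
move=> ur; elim: k => //= k IH; apply: allpairs_uniq => //.
by case=> [x s] [y t] _ _ [-> ->].
Qed.

(** Serves to pass from the [N] vertices for which code is generated to the [n <= N] that exist. *)
Lemma sum_words_filter (R : realFieldType) (a : pred V) k (F : seq V -> R) :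
  (forall s, size s = k -> ~~ all a s -> F s = 0) ->
  \sum_(s <- words r k) F s = \sum_(s <- words (filter a r) k) F s.
Proof.
elim: k F => [|k IH] F F0; first by rewrite !sum_words0.
rewrite !sum_wordsS big_filter [LHS](bigID a) /= [X in _ + X]big1 ?addr0.
  apply: eq_bigr => x ax; apply: IH => s sk nas; apply: F0; rewrite /= ?sk //.
  by rewrite ax.
move=> x /negbTE nax; rewrite big_seq big1 // => s.
by rewrite mem_words => /andP[/eqP sk _]; apply: F0; rewrite /= ?sk // nax.
Qed.
End WordsEq.

Lemma sum_words_ffun (R : realFieldType) (V : finType) k (F : seq V -> R) :
  \sum_(s <- words (enum V) k) F s = \sum_(t : {ffun 'I_k -> V}) F (codom t).
Proof.
have codE (t : {ffun 'I_k -> V}) : codom t = [seq t i | i <- enum 'I_k].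
  by congr map; apply: eq_enum.
rewrite -(big_enum (+%R) _ xpredT (fun t : {ffun 'I_k -> V} => F (codom t))) /=.
rewrite -(big_map (fun t : {ffun 'I_k -> V} => codom t) xpredT F).
apply: perm_big; apply: uniq_perm.
- exact: words_uniq (enum_uniq _).
- rewrite map_inj_uniq ?enum_uniq // => f g fg; apply/ffunP.
  change (forall i : 'I_k, f i = g i) => i.
  by rewrite -[i in LHS](nth_ord_enum i) -[i in RHS](nth_ord_enum i)
     -!(nth_map _ (f i)) ?size_enum_ord // -!codE fg.
- move=> s; rewrite mem_words; apply/andP/mapP => [[/eqP sk _]|[t _ ->]]; last first.
    by rewrite size_codom card_ord; split=> //; apply/allP => x _; rewrite /= mem_enum.
  (* The default for [nth] is built from an index in ['I_k], since [V] may be empty when [k] is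
     0. *)
  have x0 (i : 'I_k) : V by case: s sk => [|x s] sk; [case: i; rewrite -sk | exact: x].
  exists [ffun i => nth (x0 i) s i]; first by rewrite mem_enum.
  case: k codE sk x0 => [|k] codE sk x0.
    by move/size0nil: sk ->; rewrite codE (size0nil (size_enum_ord 0)).
  apply: (@eq_from_nth _ (x0 ord0)); first by rewrite size_codom card_ord.
  move=> i; rewrite sk => ik; rewrite codE (nth_map ord0) ?size_enum_ord // ffunE.
  by rewrite (nth_enum_ord ord0 ik); apply: set_nth_default; rewrite sk.
Qed.

(** * Clique counts of a graph with small tr M^4 *)

Section Counting.
Variable R : realFieldType.

(** Lagrange's identity: the squares of f_i g_j - f_j g_i sum to twice the difference of the two
    sides. *)
Lemma sum_cauchy_schwarz (I : Type) (r : seq I) (f g : I -> R) :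
  (\sum_(i <- r) f i * g i) ^+ 2 <=
  (\sum_(i <- r) f i ^+ 2) * (\sum_(i <- r) g i ^+ 2).
Proof.
have : 0 <= \sum_(i <- r) \sum_(j <- r) (f i * g j - f j * g i) ^+ 2.
  by do 2!apply: sumr_ge0 => ? _; rewrite sqr_ge0.
set F := \sum_(i <- r) f i ^+ 2; set G := \sum_(i <- r) g i ^+ 2.
set S := \sum_(i <- r) _ * _.
suff -> : \sum_(i <- r) \sum_(j <- r) (f i * g j - f j * g i) ^+ 2
   = 2 * (F * G - S ^+ 2) by move=> h; lra.
have -> : 2 * (F * G - S ^+ 2) = F * G - 2 * (S * S) + G * F by ring.
rewrite {1}/F {1}/G {1}/S !mulr_suml mulr_sumr -!(sumrB, big_split) /=.
apply: eq_bigr => i _; rewrite /F /G /S !mulr_sumr -!(sumrB, big_split) /=.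
by apply: eq_bigr => j _; ring.
Qed.

Variables (V : finType) (e : rel V) (p : R).
Hypotheses (e_sym : symmetric e) (p_ge0 : 0 <= p) (p_le1 : p <= 1).

Let M x y : R := (e x y)%:R - p.

Definition tr4 : R :=
  \sum_a \sum_b \sum_c \sum_d ((e a b)%:R - p) * ((e b c)%:R - p)
     * ((e c d)%:R - p) * ((e d a)%:R - p).

Let Q y z := \sum_x M x y * M x z.

(** By symmetry of M the matrix [Q] is M^2, so tr M^4 is its squared Frobenius norm. *)
Lemma tr4E : tr4 = \sum_y \sum_z Q y z ^+ 2.
Proof.
rewrite /tr4; apply: eq_bigr => a _; rewrite exchange_big; apply: eq_bigr => c _ /=.
rewrite expr2 /Q mulr_suml; apply: eq_bigr => b _; rewrite mulr_sumr.
apply: eq_bigr => d _; rewrite /M (e_sym a b) (e_sym c d); ring.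
Qed.

Lemma tr4_ge0 : 0 <= tr4.
Proof. by rewrite tr4E; do 2!apply: sumr_ge0 => ? _; rewrite sqr_ge0. Qed.

(** Two uses of Cauchy-Schwarz: (f^T M g)^2 <= |f|^2 |Mg|^2, and |Mg|^2 = g^T M^2 g is at most |g|^2
    times the Frobenius norm of M^2. Bounding that norm by [beta] avoids a square root. *)
Lemma bilinear_bound (beta : R) (f g : V -> R) : 0 <= beta -> tr4 <= beta ^+ 2 ->
  (\sum_x \sum_y f x * g y * ((e x y)%:R - p)) ^+ 2 <=
  beta * (\sum_x f x ^+ 2) * (\sum_y g y ^+ 2).
Proof.
move=> b0 trb; set F := \sum_x f x ^+ 2; set G := \sum_y g y ^+ 2.
have F0 : 0 <= F by apply: sumr_ge0 => ? _; rewrite sqr_ge0.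
have G0 : 0 <= G by apply: sumr_ge0 => ? _; rewrite sqr_ge0.
pose h x := \sum_y M x y * g y.
have -> : \sum_x \sum_y f x * g y * ((e x y)%:R - p) = \sum_x f x * h x.
  apply: eq_bigr => x _; rewrite /h mulr_sumr; apply: eq_bigr => y _; rewrite /M; ring.
apply: le_trans (sum_cauchy_schwarz _ _ _) _.
have -> : beta * F * G = F * (beta * G) by ring.
apply: ler_wpM2l => //; set H := \sum_x h x ^+ 2.
have H0 : 0 <= H by apply: sumr_ge0 => ? _; rewrite sqr_ge0.
rewrite -ler_sqr ?nnegrE ?mulr_ge0 //.
have -> : H = \sum_(yz : V * V) (g yz.1 * g yz.2) * Q yz.1 yz.2.
  rewrite -(pair_bigA _ (fun y z => g y * g z * Q y z)) /= /H /h /Q.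
  transitivity (\sum_x \sum_y \sum_z (M x y * g y) * (M x z * g z)).
    apply: eq_bigr => x _; rewrite expr2 mulr_suml.
    by apply: eq_bigr => y _; rewrite mulr_sumr.
  rewrite exchange_big; apply: eq_bigr => y _ /=.
  rewrite exchange_big; apply: eq_bigr => z _ /=.
  by rewrite mulr_sumr; apply: eq_bigr => x _; ring.
apply: le_trans (sum_cauchy_schwarz _ (fun yz : V * V => g yz.1 * g yz.2)
  (fun yz => Q yz.1 yz.2)) _.
have -> : \sum_(yz : V * V) Q yz.1 yz.2 ^+ 2 = tr4.
  by rewrite tr4E (pair_bigA _ (fun y z => Q y z ^+ 2)).
have -> : \sum_(yz : V * V) (g yz.1 * g yz.2) ^+ 2 = G ^+ 2.
  rewrite -(pair_bigA _ (fun y z => (g y * g z) ^+ 2)) /= expr2 {1}/G mulr_suml.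
  by apply: eq_bigr => y _; rewrite mulr_sumr; apply: eq_bigr => z _; rewrite exprMn.
by rewrite exprMn mulrC; apply: ler_wpM2r => //; rewrite sqr_ge0.
Qed.

Definition cliques k : R := \sum_(s <- words (enum V) k) (pairwise e s)%:R.

Lemma cliques_ge0 k : 0 <= cliques k.
Proof. by apply: sumr_ge0 => s _; rewrite ler0n. Qed.

Lemma pairwise_insert u x v :
  pairwise e (u ++ x :: v) = all (e x) (u ++ v) && pairwise e (u ++ v).
Proof.
rewrite !pairwise_cat pairwise_cons allrel_consr all_cat.
have -> : all (e^~ x) u = all (e x) u by apply: eq_all => y; rewrite /= e_sym.
by case: (all _ u); case: (all _ v); rewrite /= ?andbF.
Qed.

Lemma cliquesS k : cliques k.+1 =
  \sum_(w <- words (enum V) k) (pairwise e w)%:R * \sum_x (all (e x) w)%:R.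
Proof.
rewrite /cliques sum_wordsS exchange_big; apply: eq_bigr => w _ /=.
rewrite mulr_sumr big_enum; apply: eq_bigr => x _.
by rewrite mulrC -natrM mulnb.
Qed.

(* The vertex y is joined to the first j vertices of the clique by edges of e;
   each of the other k - j edges is replaced by the weight p. *)
Let hyb k j := \sum_(s <- words (enum V) k)
  (pairwise e s)%:R * p ^+ (k - j) * \sum_y (all (e y) (take j s))%:R.

(** With the clique minus its vertex x fixed as [u ++ v], this is the bilinear form of M between the
    candidates for x (common neighbours of [u ++ v]) and for y (common neighbours of [u]). *)
Let S u v : R :=
  \sum_x \sum_y (all (e x) (u ++ v))%:R * (all (e y) u)%:R * ((e x y)%:R - p).

(** Consecutive hybrids differ only in the pair x, y, where x is the letter at position j: one asks
    for the edge, the other has weight p. The pairs of y with the last l letters carry p^l in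
    both. *)
Lemma hyb_diff j l : hyb (j + l.+1) j.+1 - hyb (j + l.+1) j =
  p ^+ l * \sum_(u <- words (enum V) j) \sum_(v <- words (enum V) l)
     (pairwise e (u ++ v))%:R * S u v.
Proof.
rewrite /hyb -sumrB sum_words_cat mulr_sumr !big_seq; apply: eq_bigr => u.
rewrite mem_words => /andP[/eqP uj _].
rewrite sum_wordsS exchange_big mulr_sumr; apply: eq_bigr => v _ /=.
rewrite /S !mulr_sumr big_enum; apply: eq_bigr => x _ /=.
have -> : take j (u ++ x :: v) = u by rewrite -uj take_size_cat.
have -> : take j.+1 (u ++ x :: v) = rcons u x.
  by rewrite -cat_rcons -(_ : size (rcons u x) = j.+1) ?take_size_cat // size_rcons uj.
have -> : (j + l.+1 - j.+1 = l)%N by rewrite addnS subSS addKn.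
rewrite addKn pairwise_insert -!mulnb !natrM !mulr_sumr -sumrB.
apply: eq_bigr => y _; rewrite all_rcons -mulnb natrM e_sym exprS; ring.
Qed.

(** Cauchy-Schwarz over the cliques [u ++ v], then the bilinear bound for each [S u v]. The numbers
    of common neighbours of [u ++ v] sum to the next clique count; those of [u] are at most
    [#|V|]. *)
Lemma hyb_step (beta : R) j l : 0 <= beta -> tr4 <= beta ^+ 2 ->
  (hyb (j + l.+1) j.+1 - hyb (j + l.+1) j) ^+ 2 <=
  beta * #|V|%:R * (cliques (j + l) * cliques (j + l).+1).
Proof.
move=> b0 trb; rewrite hyb_diff exprMn.
set D := (X in _ * X ^+ 2).
apply: (@le_trans _ _ (D ^+ 2)).
  by apply: ler_piMl; rewrite ?sqr_ge0 ?exprn_ile1 ?exprn_ge0.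
pose r := [seq (u, v) | u <- words (enum V) j, v <- words (enum V) l].
pose c (w : seq V) : R := (pairwise e w)%:R.
(* An indicator equals its square, so it can weight both factors of Cauchy-Schwarz. *)
have c2 w : c w ^+ 2 = c w by rewrite /c expr2 -natrM mulnb andbb.
have -> : D = \sum_(q <- r) c (q.1 ++ q.2) * (c (q.1 ++ q.2) * S q.1 q.2).
  rewrite big_allpairs; apply: eq_bigr => u _; apply: eq_bigr => v _ /=.
  by rewrite mulrA -expr2 c2.
apply: le_trans (sum_cauchy_schwarz _ _ _) _.
have -> : \sum_(q <- r) c (q.1 ++ q.2) ^+ 2 = cliques (j + l).
  rewrite big_allpairs /cliques sum_words_cat.
  by apply: eq_bigr => u _; apply: eq_bigr => v _; rewrite c2.
rewrite mulrCA; apply: ler_wpM2l; first exact: cliques_ge0.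
rewrite cliquesS sum_words_cat big_allpairs mulr_sumr; apply: ler_sum => u _.
rewrite mulr_sumr; apply: ler_sum => v _ /=.
rewrite exprMn c2 [leRHS]mulrCA; apply: ler_wpM2l; first exact: ler0n.
apply: le_trans (bilinear_bound _ _ b0 trb) _.
have sq (b : bool) : (b%:R : R) ^+ 2 = b%:R by case: b; rewrite ?expr1n ?expr0n.
rewrite (eq_bigr _ (fun x _ => sq _)) mulrAC.
apply: ler_wpM2r; first by apply: sumr_ge0 => ? _; rewrite ler0n.
apply: ler_wpM2l => //; rewrite (eq_bigr _ (fun x _ => sq _)).
by rewrite -sum1_card natr_sum; apply: ler_sum => y _; case: (all _ _).
Qed.

(** The k + 1 hybrid differences telescope, each of size at most [B]. *)
Lemma cliques_step (beta B : R) k : 0 <= beta -> tr4 <= beta ^+ 2 -> 0 <= B ->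
  beta * #|V|%:R * (cliques k * cliques k.+1) <= B ^+ 2 ->
  `|cliques k.+2 - p ^+ k.+1 * #|V|%:R * cliques k.+1| <= k.+1%:R * B.
Proof.
move=> b0 trb B0 hB.
(* The last hybrid asks for all edges at y and so counts the larger cliques; the first leaves y
   free. *)
have -> : cliques k.+2 = hyb k.+1 k.+1.
  rewrite cliquesS /hyb !big_seq; apply: eq_bigr => w.
  by rewrite mem_words => /andP[/eqP wk _]; rewrite subnn expr0 mulr1 -wk take_size.
have -> : p ^+ k.+1 * #|V|%:R * cliques k.+1 = hyb k.+1 0.
  rewrite /cliques /hyb mulr_sumr; apply: eq_bigr => w _.
  by rewrite take0 /= -natr_sum sum1_card subn0; ring.
have : forall j, (j <= k.+1)%N -> `|hyb k.+1 j - hyb k.+1 0| <= j%:R * B.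
  elim=> [|j IH] jk; first by rewrite subrr normr0 mul0r.
  have -> : hyb k.+1 j.+1 - hyb k.+1 0 =
    (hyb k.+1 j.+1 - hyb k.+1 j) + (hyb k.+1 j - hyb k.+1 0) by ring.
  apply: le_trans (ler_normD _ _) _; rewrite -natr1 mulrDl mul1r addrC.
  apply: lerD; first exact: IH (ltnW _).
  rewrite -ler_sqr ?nnegrE // -normrX ger0_norm ?sqr_ge0 //.
  apply: le_trans hB.
  have := @hyb_step beta j (k - j) b0 trb; rewrite subnKC //.
  by have -> : (j + (k - j).+1 = k.+1)%N by rewrite addnS subnKC.
exact.
Qed.

(** Uses n^k in place of the falling factorial of the exact expectation, to match the recursion of
    [cliques_step]. *)
Definition clique_scale k : R := #|V|%:R ^+ k * p ^+ 'C(k, 2).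

Lemma clique_scaleS k : clique_scale k.+1 = p ^+ k * #|V|%:R * clique_scale k.
Proof. by rewrite /clique_scale binS bin1 exprD exprS; ring. Qed.

(** Each extension adds at most K delta to the relative error. As K^2 delta <= 1, that error never
    exceeds 1, so every count is at most twice its scale, which in turn controls the next
    extension. *)
Lemma cliques_close (delta : R) K : 0 < p -> 0 <= delta ->
  K%:R ^+ 2 * delta <= 1 ->
  tr4 <= (delta ^+ 2 * #|V|%:R ^+ 2 * p ^+ (3 * K) / 4) ^+ 2 ->
  forall k, (k <= K)%N ->
  `|cliques k - clique_scale k| <= k%:R * (K%:R * delta) * clique_scale k.
Proof.
move=> p_gt0 d0 Kd trb.
set n : R := #|V|%:R in trb *; set q := p ^+ (3 * K) in trb.
have n_ge0 : 0 <= n by rewrite ler0n.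
have q_ge0 : 0 <= q by rewrite exprn_ge0.
have sc0 k : 0 <= clique_scale k by rewrite mulr_ge0 ?exprn_ge0.
have up k : (k <= K)%N ->
    `|cliques k - clique_scale k| <= k%:R * (K%:R * delta) * clique_scale k ->
    cliques k <= 2 * clique_scale k.
  move=> kK /ler_normlP[_ h].
  have : k%:R * (K%:R * delta) * clique_scale k <= 1 * clique_scale k.
    apply: ler_wpM2r => //; apply: le_trans Kd; rewrite mulrA expr2.
    by apply: ler_wpM2r => //; apply: ler_wpM2r; rewrite ?ler0n // ler_nat.
  lra.
(* An extension involves the two preceding counts, so two consecutive bounds are carried along. *)
have H k : (k.+1 <= K)%N ->
    `|cliques k - clique_scale k| <= k%:R * (K%:R * delta) * clique_scale k /\
    `|cliques k.+1 - clique_scale k.+1| <=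
       k.+1%:R * (K%:R * delta) * clique_scale k.+1.
  elim: k => [|k IH] kK.
    have -> : cliques 0 = clique_scale 0.
      by rewrite /cliques sum_words0 /clique_scale /= mulr1.
    have -> : cliques 1 = clique_scale 1.
      rewrite cliquesS sum_words0 /clique_scale /= mul1r expr0 mulr1 expr1.
      by rewrite -natr_sum sum1_card.
    by rewrite !subrr normr0 !mul0r !mulr_ge0 // ler0n.
  have [IH0 IH1] := IH (ltnW kK); split=> //.
  have u0 := up _ (ltnW (ltnW kK)) IH0; have u1 := up _ (ltnW kK) IH1.
  (* The denominator 4 absorbs the factors 2 of [u0] and [u1]. *)
  set beta := delta ^+ 2 * n ^+ 2 * q / 4 in trb.
  have b0 : 0 <= beta by rewrite !mulr_ge0 ?exprn_ge0 ?invr_ge0.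
  have B0 : 0 <= delta * clique_scale k.+2 by rewrite mulr_ge0.
  (* The squared scale at k + 2 is n^3 p^(3k+2) times the scales at k and k + 1, and k + 2 <= K. *)
  have qle : q <= p ^+ (k.+1 + k.+1 + k).
    by apply: ler_wiXn2l => //; clear -kK; lia.
  have /(cliques_step b0 trb B0) st : beta * n * (cliques k * cliques k.+1) <=
      (delta * clique_scale k.+2) ^+ 2.
    apply: (@le_trans _ _ (beta * n * (2 * clique_scale k * (2 * clique_scale k.+1)))).
      apply: ler_wpM2l; first exact: mulr_ge0.
      by apply: ler_pM => //; apply: cliques_ge0.
    have -> : beta * n * (2 * clique_scale k * (2 * clique_scale k.+1)) =
      q * (delta ^+ 2 * n ^+ 3 * (clique_scale k * clique_scale k.+1)).
      by rewrite /beta; field.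
    have -> : (delta * clique_scale k.+2) ^+ 2 = p ^+ (k.+1 + k.+1 + k) *
      (delta ^+ 2 * n ^+ 3 * (clique_scale k * clique_scale k.+1)).
      by rewrite (clique_scaleS k.+1) (clique_scaleS k) -/n !exprD !exprS; ring.
    by apply: ler_wpM2r => //; rewrite !mulr_ge0 ?exprn_ge0.
  (* The error is the fresh one of this extension plus the old one times p^(k+1) n, which keeps its
     relative size. *)
  have -> : cliques k.+2 - clique_scale k.+2 =
      (cliques k.+2 - p ^+ k.+1 * n * cliques k.+1) +
      p ^+ k.+1 * n * (cliques k.+1 - clique_scale k.+1).
    by rewrite [clique_scale k.+2]clique_scaleS -/n; ring.
  apply: le_trans (ler_normD _ _) _.
  rewrite normrM [`|p ^+ _ * n|]ger0_norm ?mulr_ge0 ?exprn_ge0 //.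
  have {}IH1 : p ^+ k.+1 * n * `|cliques k.+1 - clique_scale k.+1| <=
       p ^+ k.+1 * n * (k.+1%:R * (K%:R * delta) * clique_scale k.+1).
    by apply: ler_wpM2l; rewrite ?mulr_ge0 ?exprn_ge0.
  have kKR : k.+1%:R * (delta * clique_scale k.+2) <= K%:R * (delta * clique_scale k.+2).
    by apply: ler_wpM2r => //; rewrite ler_nat ltnW.
  apply: le_trans (lerD (le_trans st kKR) IH1) _.
  by rewrite [clique_scale k.+2]clique_scaleS -/n -[k.+2%:R]natr1; lra.
case=> [|k] kK; last by have [] := H k kK.
rewrite /cliques sum_words0 /clique_scale /= mulr1.
by rewrite subrr normr0 !mul0r.
Qed.

End Counting.

(** * Comparison with the exact expectation *)

(** The bound n^k (1 - k^2/n) on the falling factorial, cleared of denominators; the induction rests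
    on k + k^2 <= (k + 1)^2. *)
Lemma ffact_lower (R : realFieldType) n k : (k <= n)%N ->
  n%:R ^+ k * (n%:R - k%:R ^+ 2) <= n%:R * (n ^_ k)%:R :> R.
Proof.
elim: k => [|k IH] kn; first by rewrite ffactn0 expr0; lra.
rewrite ffactnSr natrM natrB 1?ltnW //.
have n0 : (0 : R) <= n%:R by rewrite ler0n.
have k0 : (0 : R) <= k%:R by rewrite ler0n.
have nk : (k.+1%:R : R) <= n%:R by rewrite ler_nat.
rewrite -natr1 in nk *.
apply: (@le_trans _ _ (n%:R ^+ k * (n%:R - k%:R ^+ 2) * (n%:R - k%:R))); last first.
  rewrite mulrA; apply: ler_wpM2r; first lra.
  exact: IH (ltnW kn).
rewrite exprSr -!mulrA; apply: ler_wpM2l; first by rewrite exprn_ge0.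
nra.
Qed.

Lemma ffact_upper (R : realFieldType) n k : (n ^_ k)%:R <= n%:R ^+ k :> R.
Proof.
elim: k => // k IH; rewrite ffactnSr natrM exprSr.
by apply: ler_pM; rewrite ?ler0n ?ler_nat ?leq_subr.
Qed.

(* With q = p^(3K), the hypothesis n q^4 >= 1 gives (n q^2)^2 >= n, so n q^2
   exceeds any constant once n is large. *)
Lemma clique_ratio_close (R : realFieldType) (V : finType) (e : rel V)
    (p eps d : R) (K : nat) :
  symmetric e -> 0 < p -> p <= 1 -> 0 < eps -> 0 < d ->
  K%:R ^+ 2 * d <= 1 -> K%:R ^+ 2 * d <= eps / 4 ->
  (288 / d ^+ 4) ^+ 2 <= #|V|%:R -> 2 * K%:R ^+ 2 <= #|V|%:R :> R ->
  4 * K%:R ^+ 2 / eps <= #|V|%:R -> (0 < #|V|)%N ->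
  1 <= #|V|%:R * p ^+ (12 * K) ->
  tr4 e p <= 18 * #|V|%:R ^+ 3 ->
  `| cliques R e K / ((#|V| ^_ K)%:R * p ^+ 'C(K, 2)) - 1 | <= eps.
Proof.
move=> es p0 p1 eps0 d0 Kd1 Kd2 hX h2 h4 nV np trb.
have := @cliques_close R V e p es (ltW p0) p1 d K p0 (ltW d0) Kd1.
set n : R := #|V|%:R in hX h2 h4 np trb *.
have n_gt0 : 0 < n by rewrite ltr0n.
(* As 288 = 18 * 16, the bound n q^2 d^4 >= 288 puts 18 n^3 below the square n^3 (n q^2 d^4) / 16
   that [cliques_close] allows. *)
set X := 288 / d ^+ 4 in hX.
have X0 : 0 <= X by rewrite divr_ge0 ?exprn_ge0 ?ltW.
set q := p ^+ (3 * K); have q0 : 0 <= q by rewrite exprn_ge0 // ltW.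
have q4 : p ^+ (12 * K) = q ^+ 4 by rewrite -exprM; congr (_ ^+ _); clear; lia.
have Xle : X <= n * q ^+ 2.
  have nq0 : 0 <= n * q ^+ 2 by rewrite mulr_ge0 ?exprn_ge0 // ltW.
  rewrite -ler_sqr ?nnegrE //.
  have -> : (n * q ^+ 2) ^+ 2 = n * (n * q ^+ 4) by ring.
  rewrite -q4; apply: le_trans hX _.
  by rewrite ler_peMr // ltW.
have d4 : 288 <= n * q ^+ 2 * d ^+ 4 by rewrite -ler_pdivrMr ?exprn_gt0 //; exact: Xle.
have -> : (d ^+ 2 * n ^+ 2 * q / 4) ^+ 2 = n ^+ 3 * (n * q ^+ 2 * d ^+ 4) / 16 by field.
have : n ^+ 3 * 288 <= n ^+ 3 * (n * q ^+ 2 * d ^+ 4).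
  by apply: ler_wpM2l => //; rewrite exprn_ge0 // ltW.
move=> h3 hclose; have {hclose} : `|cliques R e K - clique_scale V p K| <=
    K%:R * (K%:R * d) * clique_scale V p K by apply: hclose => //; lra.
set N := cliques R e K; rewrite /clique_scale -/n; set P := p ^+ 'C(K, 2).
have P0 : 0 < P by rewrite exprn_gt0.
have Kn : (K <= #|V|)%N.
  rewrite -(ler_nat R) -/n; apply: le_trans h2.
  rewrite -natrX -natrM ler_nat expnS expn1.
  by case: (K) => // k; rewrite mulnCA leq_pmulr.
have lo := ffact_lower R Kn; have up := ffact_upper R #|V| K.
rewrite -/n in lo up.
set F : R := (#|V| ^_ K)%:R in lo up *; set m := n ^+ K in lo up *.
have m0 : 0 < m by rewrite exprn_gt0.
have hK2 : K%:R ^+ 2 <= n * (1 / 2) by lra.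
have hK4 : K%:R ^+ 2 <= n * (eps / 4).
  have : 4 * K%:R ^+ 2 / eps <= n by lra.
  by rewrite ler_pdivrMr //; lra.
have F2 : m * (1 / 2) <= F.
  rewrite -(ler_pM2l n_gt0); apply: le_trans lo.
  have -> : n * (m * (1 / 2)) = m * (n * (1 / 2)) by ring.
  by rewrite ler_pM2l //; lra.
have F4 : m - F <= m * (eps / 4).
  suff : m * (1 - eps / 4) <= F by lra.
  rewrite -(ler_pM2l n_gt0); apply: le_trans lo.
  have -> : n * (m * (1 - eps / 4)) = m * (n - n * (eps / 4)) by ring.
  by rewrite ler_pM2l //; lra.
have F0 : 0 < F by lra.
have FP0 : 0 < F * P by apply: mulr_gt0.
move=> close.
have -> : N / (F * P) - 1 = (N - F * P) / (F * P).
  by rewrite mulrBl divff // gt_eqF.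
rewrite normrM normfV (gtr0_norm FP0) ler_pdivrMr //.
(* Both summands are at most (eps/4) m P, and m <= 2F bounds their sum by eps F P. *)
have -> : N - F * P = (N - m * P) + (m - F) * P by ring.
apply: le_trans (ler_normD _ _) _.
have mF0 : 0 <= (m - F) * P by apply: mulr_ge0; [lra | exact: ltW].
rewrite [`|(m - F) * P|]ger0_norm //.
have c2 : K%:R * (K%:R * d) * (m * P) <= eps / 4 * (m * P).
  apply: ler_wpM2r; first by apply: mulr_ge0; apply: ltW.
  by rewrite mulrA -expr2.
have c3 : (m - F) * P <= m * (eps / 4) * P by apply: ler_wpM2r => //; apply: ltW.
have c4 : eps * P * (m * (1 / 2)) <= eps * P * F.
  by apply: ler_wpM2l => //; apply: mulr_ge0; apply: ltW.
lra.
Qed.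

(** The threshold depends on eps and K but not on p, so a program can contain it as a constant. *)
Lemma clique_ratio_close_eventually (R : archiRealFieldType) (eps : R) (K : nat) :
  0 < eps -> exists n0 : nat, forall (V : finType) (e : rel V) (p : R),
  symmetric e -> 0 < p -> p <= 1 -> (n0 < #|V|)%N ->
  1 <= #|V|%:R * p ^+ (12 * K) ->
  tr4 e p <= 18 * #|V|%:R ^+ 3 ->
  `| cliques R e K / ((#|V| ^_ K)%:R * p ^+ 'C(K, 2)) - 1 | <= eps.
Proof.
move=> eps0.
have [d [d0 Kd1 Kd2]] : exists d : R,
    [/\ 0 < d, K%:R ^+ 2 * d <= 1 & K%:R ^+ 2 * d <= eps / 4].
  exists (Num.min 1 (eps / 4) / (K%:R ^+ 2 + 1)).
  have K0 : 0 <= (K%:R : R) ^+ 2 by rewrite exprn_ge0.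
  have m0 : 0 < Num.min 1 (eps / 4) by rewrite lt_min; apply/andP; split; lra.
  have le : K%:R ^+ 2 * (Num.min 1 (eps / 4) / (K%:R ^+ 2 + 1)) <= Num.min 1 (eps / 4).
    by rewrite mulrA ler_pdivrMr; [lra | lra].
  split; first by apply: divr_gt0; lra.
    by apply: le_trans le _; rewrite ge_min lexx.
  by apply: le_trans le _; rewrite ge_min lexx orbT.
exists (Num.bound ((288 / d ^+ 4) ^+ 2) + Num.bound (2 * K%:R ^+ 2 : R)
   + Num.bound (4 * K%:R ^+ 2 / eps))%N => V e p es p0 p1 nV np trb.
have bnd (x : R) m : (Num.bound x <= m)%N -> x <= m%:R.
  move=> h; apply: le_trans (ler_norm x) _.
  have /andP[_ /ltW hx] := Num.Theory.truncn_itv (normr_ge0 x).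
  by apply: le_trans hx _; rewrite ler_nat.
have [b1 b2 b3 b4] : [/\ 0 < #|V|, Num.bound ((288 / d ^+ 4) ^+ 2) <= #|V|,
    Num.bound (2 * K%:R ^+ 2 : R) <= #|V| & Num.bound (4 * K%:R ^+ 2 / eps) <= #|V|]%N.
  by move: nV; clear; split; lia.
by apply: (clique_ratio_close es p0 p1 eps0 d0 Kd1 Kd2) => //; exact: bnd.
Qed.

(** * Expectations under G(n,p) *)

Section Gnp.
Variables (R : realType) (n : nat) (p : R).
Hypotheses (p_ge0 : 0 <= p) (p_le1 : p <= 1).

Lemma graph_sym (G : graph n) : symmetric (fun i j => G i j).
Proof. by case: G => M /= /andP[_ /forallP s] i j; have /forallP/(_ j)/eqP := s i. Qed.

Lemma graph_irr (G : graph n) i : G i i = false.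
Proof. by case: G => M /= /andP[/forallP s _]; apply/negbTE. Qed.

Lemma graph_eqP (G H : graph n) : (forall i j, G i j = H i j) -> G = H.
Proof. by move=> GH; apply: val_inj; apply/matrixP => i j; exact: GH. Qed.

Lemma graph_cond_total (f : 'I_n -> 'I_n -> bool) :
  is_adjacency (\matrix_(i, j) if (i < j)%N then f i j else (j < i)%N && f j i).
Proof.
apply/andP; split; first by apply/forallP => i; rewrite mxE ltnn.
apply/forallP => i; apply/forallP => j; rewrite !mxE.
by case: (ltngtP i j).
Qed.

Definition edge_weight (b : bool) : R := if b then p else 1 - p.

Lemma edge_weight_ge0 b : 0 <= edge_weight b.
Proof. by case: b; rewrite /edge_weight ?subr_ge0. Qed.

Lemma gnpE (G : graph n) :
  gnp p G = \prod_(e : 'I_n * 'I_n | (e.1 < e.2)%N) edge_weight (G e.1 e.2).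
Proof.
by rewrite /gnp (pair_big_dep xpredT (fun i j : 'I_n => (i < j)%N)
  (fun i j => edge_weight (G i j))).
Qed.

Lemma gnp_ge0 (G : graph n) : 0 <= gnp p G.
Proof. by rewrite gnpE; apply: prodr_ge0 => e _; apply: edge_weight_ge0. Qed.

(** Expand the product of p + (1 - p) over all pairs. Outside the upper triangle [H] gives weight 1
    to false and 0 to true, so only functions supported on the triangle survive, and these
    correspond to graphs. *)
Lemma gnp_total : \sum_(G : graph n) gnp p G = 1.
Proof.
pose H (e : 'I_n * 'I_n) (b : bool) : R :=
  if (e.1 < e.2)%N then edge_weight b else (~~ b)%:R.
have : \prod_(e : 'I_n * 'I_n) \sum_(b : bool) H e b = 1.
  apply: big1 => e _; rewrite big_bool /H /edge_weight.
  by case: ifP => _ /=; ring.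
rewrite (bigA_distr_bigA (times := *%R) (plus := +%R)) /= => <-.
pose up (f : {ffun 'I_n * 'I_n -> bool}) := [forall e, f e ==> (e.1 < e.2)%N].
rewrite [RHS](bigID up) /= [X in _ + X]big1 ?addr0; last first.
  move=> f /forallPn[e]; rewrite negb_imply => /andP[fe /negbTE ne].
  by rewrite (bigD1 e) //= /H ne fe mul0r.
pose toG (f : {ffun 'I_n * 'I_n -> bool}) := Graph (graph_cond_total (fun i j => f (i, j))).
pose ofG (G : graph n) := [ffun e : 'I_n * 'I_n => (e.1 < e.2)%N && G e.1 e.2].
rewrite (reindex_onto ofG toG) /=; last first.
  move=> f /forallP uf; apply/ffunP => -[i j]; rewrite ffunE /= mxE.
  by have := uf (i, j) => /=; case: ltnP => //=; case: (f _).
apply: eq_big => [G|G _].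
  symmetry; apply/andP; split.
    by apply/forallP => e; rewrite ffunE; apply/implyP => /andP[].
  apply/eqP/graph_eqP => i j; rewrite /= mxE !ffunE /=.
  case: ltngtP => // ij; first by rewrite graph_sym.
  by rewrite (val_inj ij) graph_irr.
rewrite gnpE [RHS](bigID (fun e : 'I_n * 'I_n => (e.1 < e.2)%N)) /= [X in _ * X]big1 ?mulr1.
  by apply: eq_bigr => e lte; rewrite /H lte ffunE lte.
by move=> e /negbTE ne; rewrite /H ne ffunE ne.
Qed.

Definition is_edge (a b i j : 'I_n) : bool :=
  ((i == a) && (j == b)) || ((i == b) && (j == a)).

Lemma toggle_subproof (a b : 'I_n) (ab : a != b) (G : graph n) :
  is_adjacency (\matrix_(i, j) (G i j (+) is_edge a b i j)).
Proof.
apply/andP; split.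
  apply/forallP => i; rewrite mxE graph_irr /is_edge.
  by apply/negP => /orP[] /andP[/eqP ia /eqP ib]; move: ab; rewrite -ia -ib eqxx.
apply/forallP => i; apply/forallP => j; rewrite !mxE graph_sym /is_edge.
by rewrite [_ || _ in eqbRHS]orbC ![(j == _) && _]andbC.
Qed.

Definition toggle a b (ab : a != b) G : graph n := Graph (toggle_subproof ab G).

Lemma toggleE a b (ab : a != b) G i j :
  toggle ab G i j = G i j (+) is_edge a b i j.
Proof. by rewrite /= mxE. Qed.

Lemma toggleK a b (ab : a != b) : involutive (toggle ab).
Proof. by move=> G; apply: graph_eqP => i j; rewrite !toggleE addbK. Qed.

Lemma gnp_toggle (a b : 'I_n) (ab : a != b) : exists r : graph n -> R,
  (forall G, gnp p G = edge_weight (G a b) * r G) /\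
  (forall G, r (toggle ab G) = r G).
Proof.
wlog lt_ab : a b ab / (a < b)%N => [hw|].
  case: (ltngtP a b) => [lt|lt|/val_inj e]; last by exfalso; move: (ab); rewrite e eqxx.
    exact: hw lt.
  have ba : b != a by rewrite eq_sym.
  have [r [r1 r2]] := hw b a ba lt; exists r; split=> G.
    by rewrite graph_sym.
  rewrite -(r2 G); congr r; apply: graph_eqP => i j; rewrite !toggleE.
  by rewrite /is_edge orbC.
exists (fun G => \prod_(e : 'I_n * 'I_n | (e.1 < e.2)%N && (e != (a, b)))
          edge_weight (G e.1 e.2)); split=> G.
  by rewrite gnpE (bigD1 (a, b)).
apply: eq_bigr => -[i j] /andP[/= lij nij]; rewrite (toggleE ab) /is_edge.
suff -> : (i == a) && (j == b) || (i == b) && (j == a) = false by rewrite addbF.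
move: nij; rewrite xpair_eqE => /negbTE -> /=.
by apply/negP => /andP[/eqP ib /eqP ja]; move: lij; rewrite ib ja ltnNge ltnW.
Qed.

Definition expect (f : graph n -> R) : R := \sum_(G : graph n) gnp p G * f G.

(* Resampling: pair each graph with the one obtained by toggling the edge ab. *)
Lemma expect_edge (a b : 'I_n) (ab : a != b) (f : graph n -> R) :
  (forall G, f (toggle ab G) = f G) ->
  expect (fun G => (G a b)%:R * f G) = p * expect f.
Proof.
move=> ft; have [r [r1 r2]] := gnp_toggle ab.
(* In the doubled sum each graph meets its toggle, and exactly one of the two has the edge. The
   cases of the indicator and of the constant 1 then differ by the factor p. *)
have avg (phi : bool -> R) : \sum_(G : graph n) gnp p G * (phi (G a b) * f G) * 2 =
    (p * phi true + (1 - p) * phi false) * \sum_(G : graph n) r G * f G.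
  rewrite mulr_sumr -mulr_suml mulr_natr mulr2n.
  rewrite [X in _ + X](reindex_inj (inv_inj (toggleK ab))) /= -big_split /=.
  apply: eq_bigr => G _; rewrite !r1 r2 ft toggleE /is_edge !eqxx /= addbT.
  by rewrite /edge_weight; case: (G a b) => /=; ring.
have e1 := avg (fun b => b%:R); have e0 := avg (fun _ => 1).
rewrite -mulr_suml in e1; rewrite -mulr_suml in e0.
rewrite /expect; under [in RHS]eq_bigr do rewrite -[f _]mul1r.
apply: (@mulIf _ 2); first by rewrite pnatr_eq0.
by rewrite e1 -mulrA e0 /=; ring.
Qed.

Definition edge (G : graph n) : rel 'I_n := fun i j => G i j.

(** The edges from x to [t] are averaged out one at a time; they are distinct, and none lies inside
    [s]. *)
Lemma expect_star (x : 'I_n) (t s : seq 'I_n) : x \notin t -> uniq t -> x \notin s ->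
  expect (fun G => (all (edge G x) t)%:R * (pairwise (edge G) s)%:R) =
  p ^+ size t * expect (fun G => (pairwise (edge G) s)%:R).
Proof.
move=> + + xs; elim: t => [|y t IH] /=.
  by move=> _ _; rewrite mul1r; apply: eq_bigr => G _; rewrite mul1r.
rewrite inE negb_or => /andP[xy xt] /andP[yt ut].
rewrite exprS -mulrA -IH // -(@expect_edge _ _ xy) /=.
  by rewrite /expect; apply: eq_bigr => G _; rewrite -mulnb natrM !mulrA.
move=> G; congr (_%:R * _%:R); congr nat_of_bool.
  apply: eq_in_all => z zt; rewrite /edge (toggleE xy) /is_edge eqxx (negbTE xy) /=.
  by case: eqP => [zy|_]; [rewrite -zy zt in yt | rewrite addbF].
apply: (@eq_in_pairwise _ (fun i => i != x)).
  move=> i j; rewrite ![_ \in _]/(_ != x) => /negbTE ix /negbTE jx.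
  by rewrite /edge (toggleE xy) /is_edge ix jx !andbF addbF.
by apply/allP => i si; apply: contraNneq xs => <-.
Qed.

Lemma expect_clique (s : seq 'I_n) : uniq s ->
  expect (fun G => (pairwise (edge G) s)%:R) = p ^+ 'C(size s, 2).
Proof.
elim: s => [|x s IH] /=.
  by move=> _; rewrite /expect -[RHS]gnp_total; apply: eq_bigr => G _; rewrite mulr1.
move=> /andP[xs us]; rewrite binS bin1 addnC exprD -IH // -(expect_star xs us xs).
by apply: eq_bigr => G _; rewrite -mulnb natrM.
Qed.

Lemma pairwise_codom k (e : rel 'I_n) (t : {ffun 'I_k -> 'I_n}) : symmetric e ->
  pairwise e (codom t) = [forall i, forall j, (i != j) ==> e (t i) (t j)].
Proof.
move=> es; have -> : codom t = map t (enum 'I_k) by congr map; apply: eq_enum.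
rewrite pairwise_map; apply/idP/forallP => [pw i|h].
  apply/forallP => j; apply/implyP.
  wlog ij : i j / (i < j)%N => [hw|_].
    by rewrite neq_ltn => /orP[] ij; [|rewrite es]; apply: hw; rewrite // neq_ltn ij.
  have /(pairwiseP i)/(_ i j) := pw; rewrite !inE !size_enum_ord !ltn_ord !nth_ord_enum.
  exact.
have := enum_uniq 'I_k; rewrite uniq_pairwise; apply: sub_pairwise => i j /=.
by move=> ij; have /forallP/(_ j)/implyP/(_ ij) := h i.
Qed.

Lemma nb_cliquesE k (G : graph n) : (nb_cliques k G)%:R = cliques R (edge G) k.
Proof.
rewrite /cliques sum_words_ffun /nb_cliques -sum1_card natr_sum big_mkcond /=.
apply: eq_bigr => t _; rewrite inE -pairwise_codom; last exact: graph_sym.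
by case: (pairwise _ _).
Qed.

Lemma sum_uniq_words k :
  \sum_(s <- words (enum 'I_n) k) (uniq s)%:R = (n ^_ k)%:R :> R.
Proof.
rewrite sum_words_ffun -natr_sum; congr _%:R.
have -> : n ^_ k = #|[set t : {ffun 'I_k -> 'I_n} | injectiveb t]|.
  by rewrite card_inj_ffuns !card_ord.
rewrite -sum1_card [RHS]big_mkcond.
by apply: eq_bigr => t _; rewrite inE /injectiveb /dinjectiveb; case: (uniq _).
Qed.

Lemma expected_cliquesE k :
  expected_cliques n k p = (n ^_ k)%:R * p ^+ 'C(k, 2).
Proof.
rewrite /expected_cliques -sum_uniq_words mulr_suml.
transitivity (\sum_(G : graph n) \sum_(s <- words (enum 'I_n) k)
    gnp p G * (pairwise (edge G) s)%:R).
  by apply: eq_bigr => G _; rewrite nb_cliquesE /cliques mulr_sumr.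
rewrite exchange_big !big_seq; apply: eq_bigr => s; rewrite mem_words => /andP[/eqP sk _].
case: (boolP (uniq s)) => us /=; first by rewrite mul1r -sk -expect_clique.
rewrite mul0r big1 // => G _; rewrite (_ : pairwise _ _ = false) ?mulr0 //.
by apply: contraNF us; apply: pairwise_uniq => i; apply: graph_irr.
Qed.

Lemma expect_sum (I : finType) (F : graph n -> I -> R) :
  expect (fun G => \sum_i F G i) = \sum_i expect (fun G => F G i).
Proof. by rewrite /expect exchange_big; apply: eq_bigr => G _; rewrite mulr_sumr. Qed.

(** For distinct vertices the edge ab enters the first factor only, and averaging over it gives p -
    p. *)
Lemma expect_cycle4 (a b c d : 'I_n) : uniq [:: a; b; c; d] ->
  expect (fun G => ((edge G a b)%:R - p) * ((edge G b c)%:R - p)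
     * ((edge G c d)%:R - p) * ((edge G d a)%:R - p)) = 0.
Proof.
rewrite /= !inE !negb_or -!andbA => /and5P[ab ac ad bc /and3P[bd cd _]].
pose f G := ((edge G b c)%:R - p) * ((edge G c d)%:R - p) * ((edge G d a)%:R - p).
transitivity (expect (fun G => (G a b)%:R * f G) - p * expect f).
  rewrite /expect mulr_sumr -sumrB; apply: eq_bigr => G _; rewrite /f /edge; ring.
rewrite (@expect_edge _ _ ab) ?subrr // => G.
rewrite /f /edge !(toggleE ab) /is_edge.
rewrite ![b == a]eq_sym ![c == a]eq_sym ![d == a]eq_sym ![c == b]eq_sym ![d == b]eq_sym.
rewrite (negbTE ab) (negbTE ac) (negbTE ad) (negbTE bc) (negbTE bd).
by rewrite !andbF /= !addbF.
Qed.

(** Every term is at most 1 in absolute value and has mean 0 unless two of the four vertices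
    coincide; each of the six possible coincidences accounts for n^3 walks. *)
Lemma expect_tr4 : expect (fun G => tr4 (edge G) p) <= 6 * n%:R ^+ 3.
Proof.
pose t (G : graph n) a b c d : R := ((edge G a b)%:R - p) * ((edge G b c)%:R - p)
     * ((edge G c d)%:R - p) * ((edge G d a)%:R - p).
pose D (a b c d : 'I_n) : R := (a == b)%:R + (a == c)%:R + (a == d)%:R + (b == c)%:R
   + (b == d)%:R + (c == d)%:R.
have tD a b c d : expect (fun G => t G a b c d) <= D a b c d.
  case: (boolP (uniq [:: a; b; c; d])) => [u|nu].
    by rewrite expect_cycle4 // /D !addr_ge0.
  have D1 : 1 <= D a b c d.
    move: nu; rewrite /= !inE /D.
    by case: (a == b); case: (a == c); case: (a == d); case: (b == c);
       case: (b == d); case: (c == d) => //= _; lra.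
  apply: le_trans D1; rewrite -gnp_total; apply: ler_sum => G _.
  apply: ler_piMr; first exact: gnp_ge0.
  apply: le_trans (ler_norm _) _; rewrite /t !normrM.
  have M1 i j : `|(edge G i j)%:R - p| <= 1.
    by case: (edge G i j); rewrite ler_norml; apply/andP; split=> /=; move: p_ge0 p_le1; lra.
  by rewrite !mulr_ile1 ?mulr_ge0.
have -> : 6 * n%:R ^+ 3 = \sum_a \sum_b \sum_c \sum_d D a b c d.
  have one (x : 'I_n) : \sum_y (x == y)%:R = 1 :> R.
    rewrite (bigD1 x) //= eqxx big1 ?addr0 // => y.
    by rewrite eq_sym => /negbTE ->.
  have cst (x : R) : \sum_(y < n) x = n%:R * x.
    by rewrite sumr_const card_ord mulr_natl.
  transitivity (\sum_(a < n) (6 * n%:R ^+ 2 : R)); first by rewrite cst; ring.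
  apply: eq_bigr => a _.
  transitivity (\sum_(b < n) (n%:R ^+ 2 * (a == b)%:R + 5 * n%:R : R)).
    by rewrite big_split /= -mulr_sumr one cst; ring.
  apply: eq_bigr => b _.
  transitivity (\sum_(c < n)
      (n%:R * ((a == b)%:R + (a == c)%:R + (b == c)%:R) + 3 : R)).
    by rewrite big_split /= -mulr_sumr !big_split /= !one !cst; ring.
  apply: eq_bigr => c _.
  by rewrite /D !big_split /= !one !cst; ring.
rewrite /tr4 expect_sum; apply: ler_sum => a _.
rewrite expect_sum; apply: ler_sum => b _.
rewrite expect_sum; apply: ler_sum => c _.
by rewrite expect_sum; apply: ler_sum => d _; exact: tD.
Qed.

(** Markov's inequality: tr M^4 is nonnegative, and 18 is three times the 6 of the mean bound. *)
Lemma tr4_typical : (0 < n)%N ->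
  2%:R / 3%:R <= \sum_(G : graph n | tr4 (edge G) p <= 18 * n%:R ^+ 3) gnp p G.
Proof.
move=> n0; pose good (G : graph n) := tr4 (edge G) p <= 18 * n%:R ^+ 3.
change (2%:R / 3%:R <= \sum_(G | good G) gnp p G).
have := gnp_total; rewrite (bigID good) /=.
set A := \sum_(G | good G) _; set B := \sum_(G | ~~ good G) _ => AB.
have n3 : 0 < 18 * n%:R ^+ 3 :> R by rewrite mulr_gt0 ?exprn_gt0 ?ltr0n.
suff : 18 * n%:R ^+ 3 * B <= 6 * n%:R ^+ 3.
  have -> : 6 * n%:R ^+ 3 = 18 * n%:R ^+ 3 * (1 / 3) :> R by field.
  by rewrite ler_pM2l //; lra.
apply: le_trans expect_tr4; rewrite /expect (bigID good) /= /B mulr_sumr.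
apply: ler_wpDl.
  apply: sumr_ge0 => G _; rewrite mulr_ge0 ?gnp_ge0 ?tr4_ge0 //; exact: graph_sym.
apply: ler_sum => G; rewrite /good -ltNge => /ltW h.
by rewrite mulrC; apply: ler_wpM2l => //; exact: gnp_ge0.
Qed.

End Gnp.

(** * Reasoning about machine runs *)

Definition no_flip (ins : instr) : bool := if ins is IFlip _ then false else true.

Definition straight (ins : instr) : bool :=
  match ins with
  | IFlip _ | Jump _ | IJumpLe _ _ _ | RJumpLe _ _ _ | Halt _ => false
  | _ => true
  end.

Lemma onth_all (a : pred instr) (P : program) i ins :
  all a P -> onth P i = Some ins -> a ins.
Proof.
elim: P i => [|x P IH] [|i] //= /andP[ax aP]; first by case=> <-.
exact: IH.
Qed.

Section Machine.
Variables (R : realType) (P : program) (n : nat) (G : graph n).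

Definition dstep (c : config R) := step P G c false.

(** Only [IFlip] reads a coin, so without it all coins may be taken false. *)
Lemma foldl_step (c : config R) (r : seq bool) :
  all no_flip P -> foldl (step P G) c r = iter (size r) dstep c.
Proof.
move=> nf; elim: r c => //= b r IH c; rewrite IH -iterS iterSr; congr iter.
rewrite /dstep /step; case: (answer c) => //; case E: (onth P (pc c)) => [ins|] //.
by have := onth_all nf E; case: ins E.
Qed.

(** A bound on the time rather than its exact value, so that branches of different length can share
    it. *)
Definition reaches (c : config R) (m : nat) (Q : config R -> Prop) : Prop :=
  exists2 m', (m' <= m)%N & Q (iter m' dstep c).

Lemma reaches0 c m (Q : config R -> Prop) : Q c -> reaches c m Q.
Proof. by exists 0%N. Qed.

Lemma reachesS c m (Q : config R -> Prop) : reaches (dstep c) m Q -> reaches c m.+1 Q.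
Proof. by case=> m' m'm q; exists m'.+1; rewrite // iterSr. Qed.

Lemma reaches_trans c m1 m2 (Q1 Q2 : config R -> Prop) :
  reaches c m1 Q1 -> (forall c', Q1 c' -> reaches c' m2 Q2) -> reaches c (m1 + m2) Q2.
Proof.
move=> [a am q1] /(_ _ q1)[b bm q2]; exists (b + a)%N; last by rewrite iterD.
by rewrite addnC leq_add.
Qed.

(** A configuration with an answer is fixed by [step], so the answer persists until time [T]. *)
Lemma reaches_answer c m T b : (m <= T)%N ->
  reaches c m (fun c' => answer c' = Some b) -> answer (iter T dstep c) = Some b.
Proof.
move=> mT [a am ab]; rewrite -(subnK (leq_trans am mT)) iterD.
elim: (T - a)%N => //= k IH.
by rewrite {1}/dstep /step IH.
Qed.

Lemma reaches_loop (I : nat -> config R -> Prop) (N s s' : nat) (Q : config R -> Prop) c :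
  (forall v c, (v < N)%N -> I v c -> reaches c s (I v.+1)) ->
  (forall c, I N c -> reaches c s' Q) ->
  I 0%N c -> reaches c (N * s + s') Q.
Proof.
move=> body exit I0.
suff H k : (k <= N)%N -> reaches c (k * s) (I k) by apply: reaches_trans (H N _) exit.
elim: k => [|k IH] kN; first exact: reaches0.
rewrite mulSn addnC; apply: reaches_trans (IH (ltnW kN)) _ => c'; exact: body.
Qed.

Lemma run_straight (A code B : program) c :
  P = A ++ code ++ B -> all straight code -> pc c = size A -> answer c = None ->
  [/\ iter (size code) dstep c = foldl (exec G false) c code,
      pc (foldl (exec G false) c code) = (size A + size code)%N &
      answer (foldl (exec G false) c code) = None].
Proof.
elim: code A c => [|i code IH] A c PE /=; first by rewrite addn0.
case/andP=> si sc pcA ans.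
have stepE : dstep c = exec G false c i.
  by rewrite /dstep /step ans pcA PE onth_cat ltnn subnn.
have [] := IH (rcons A i) (exec G false c i); rewrite ?cat_rcons //.
- by rewrite size_rcons -pcA; case: i si {stepE PE}.
- by case: i si {stepE PE}.
by rewrite size_rcons addSnnS -stepE -iterSr.
Qed.

End Machine.

(** * The program that evaluates tr M^4 *)

(** The cost of four nested loops: 19 steps per innermost pass, 4 more per outer pass, 1 per exit,
    with 4 steps before and 8 after. *)
Lemma nested_loop_bound n : (0 < n)%N ->
  (4 + (n * (n * (n * (n * 19 + 1 + 4) + 1 + 4) + 1 + 4) + 1 + 8) <= 60 * n ^ 4)%N.
Proof.
move=> n0; have -> : (n ^ 4 = n * n * n * n)%N by rewrite !expnS expn0; lia.
have h1 : (n <= n * n)%N by nia.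
have h2 : (n * n <= n * n * n)%N by nia.
have h3 : (n * n * n <= n * n * n * n)%N by nia.
nia.
Qed.

Ltac mstep := apply: reachesS; rewrite /dstep /step /= /upd /=.

Section TraceProgram.
Variables (R : realType) (n : nat) (G : graph n) (p : R) (n0 : nat) (tail : program).

(* z_2, ..., z_5 are the loop counters and x_2 the accumulator. For n <= n0
   control passes to the code appended at address 44. *)
Definition trace_code (n0 : nat) : program :=
  [:: IConst 1 n0; IJumpLe 0 1 44;
      IConst 1 1; IConst 2 0;
      IJumpLe 0 2 35; IConst 3 0;
      IJumpLe 0 3 33; IConst 4 0;
      IJumpLe 0 4 31; IConst 5 0;
      IJumpLe 0 5 29;
      IAdj 6 2 3; ROfInt 3 6; RSub 3 3 0;
      IAdj 6 3 4; ROfInt 4 6; RSub 4 4 0; RMul 3 3 4;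
      IAdj 6 4 5; ROfInt 4 6; RSub 4 4 0; RMul 3 3 4;
      IAdj 6 5 2; ROfInt 4 6; RSub 4 4 0; RMul 3 3 4;
      RAdd 2 2 3;
      IAdd 5 5 1; Jump 10;
      IAdd 4 4 1; Jump 8;
      IAdd 3 3 1; Jump 6;
      IAdd 2 2 1; Jump 4;
      ROfInt 3 0; RMul 4 3 3; RMul 4 4 3; IConst 1 18; ROfInt 3 1; RMul 4 3 4;
      RJumpLe 2 4 43; Halt false; Halt true].

Let P := trace_code n0 ++ tail.

(** [l] lists the loop counters in use, from z_2 on; z_1 holds the 1 that increments them. *)
Definition loop_state (q : nat) (l : seq nat) (acc : R) (c : config R) : Prop :=
  [/\ pc c = q, answer c = None,
      [:: ireg c 0, ireg c 1 & [seq ireg c i | i <- iota 2 (size l)]] = [:: n, 1%N & l],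
      rreg c 0 = p & rreg c 2 = acc].

Let M a b : R := (adj_query G a b)%:R - p.

Lemma loop_d a b c acc cf : loop_state 10 [:: a; b; c; 0%N] acc cf ->
  reaches P G cf (n * 19 + 1) (loop_state 29 [:: a; b; c]
     (acc + \sum_(0 <= d < n) M a b * M b c * M c d * M d a)).
Proof.
move=> st; apply: (@reaches_loop _ _ _ _ (fun d => loop_state 10 [:: a; b; c; d]
  (acc + \sum_(0 <= d < d) M a b * M b c * M c d * M d a))).
- move=> d [q z x an] dn [/= -> -> [z0 z1 z2 z3 z4 z5] x0 x2].
  mstep; rewrite z0 z5 leqNgt dn /=.
  do 18!mstep.
  apply: reaches0; split=> //=.
    by rewrite z0 z1 z2 z3 z4 z5 addn1.
  by rewrite big_nat_recr //= addrA x2 z2 z3 z4 z5 x0.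
- move=> [q z x an] [/= -> -> [z0 z1 z2 z3 z4 z5] x0 x2].
  mstep; rewrite z0 z5 leqnn /=; apply: reaches0; split=> //=.
  by rewrite z0 z1 z2 z3 z4.
- by rewrite big_geq // addr0.
Qed.

Let Sd a b c := \sum_(0 <= d < n) M a b * M b c * M c d * M d a.
Let td := (n * 19 + 1)%N.

Lemma loop_c a b acc cf : loop_state 8 [:: a; b; 0%N] acc cf ->
  reaches P G cf (n * (td + 4) + 1) (loop_state 31 [:: a; b]
     (acc + \sum_(0 <= c < n) Sd a b c)).
Proof.
move=> st; apply: (@reaches_loop _ _ _ _ (fun c => loop_state 8 [:: a; b; c]
  (acc + \sum_(0 <= c < c) Sd a b c))).
- move=> c [q z x an] cn [/= -> -> [z0 z1 z2 z3 z4] x0 x2].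
  (* Of the 4 extra steps, the test and the reset of z_5 precede the inner loop; the increment and
     the jump follow it. *)
  rewrite addnC; mstep; rewrite z0 z4 leqNgt cn /=; mstep.
  rewrite -(addn2 td); apply: reaches_trans.
    by apply: (@loop_d a b c); split; rewrite ?x2 //= z0 z1 z2 z3 z4.
  move=> [q' z' x' an'] [/= -> -> [z0' z1' z2' z3' z4'] x0' x2'].
  do 2!mstep; apply: reaches0; split=> //=; first by rewrite z0' z1' z2' z3' z4' addn1.
  by rewrite big_nat_recr //= addrA x2' x2.
- move=> [q z x an] [/= -> -> [z0 z1 z2 z3 z4] x0 x2].
  mstep; rewrite z0 z4 leqnn /=; apply: reaches0; split=> //=.
  by rewrite z0 z1 z2 z3.
- by rewrite big_geq // addr0.
Qed.

Let tc := (n * (td + 4) + 1)%N.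

Lemma loop_b a acc cf : loop_state 6 [:: a; 0%N] acc cf ->
  reaches P G cf (n * (tc + 4) + 1) (loop_state 33 [:: a]
     (acc + \sum_(0 <= b < n) \sum_(0 <= c < n) Sd a b c)).
Proof.
move=> st; apply: (@reaches_loop _ _ _ _ (fun b => loop_state 6 [:: a; b]
  (acc + \sum_(0 <= b < b) \sum_(0 <= c < n) Sd a b c))).
- move=> b [q z x an] bn [/= -> -> [z0 z1 z2 z3] x0 x2].
  rewrite addnC; mstep; rewrite z0 z3 leqNgt bn /=; mstep.
  rewrite -(addn2 tc); apply: reaches_trans.
    by apply: (@loop_c a b); split; rewrite ?x2 //= z0 z1 z2 z3.
  move=> [q' z' x' an'] [/= -> -> [z0' z1' z2' z3'] x0' x2'].
  do 2!mstep; apply: reaches0; split=> //=; first by rewrite z0' z1' z2' z3' addn1.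
  by rewrite big_nat_recr //= addrA x2' x2.
- move=> [q z x an] [/= -> -> [z0 z1 z2 z3] x0 x2].
  mstep; rewrite z0 z3 leqnn /=; apply: reaches0; split=> //=.
  by rewrite z0 z1 z2.
- by rewrite big_geq // addr0.
Qed.

Let tb := (n * (tc + 4) + 1)%N.

Lemma loop_a acc cf : loop_state 4 [:: 0%N] acc cf ->
  reaches P G cf (n * (tb + 4) + 1) (loop_state 35 [::]
     (acc + \sum_(0 <= a < n) \sum_(0 <= b < n) \sum_(0 <= c < n) Sd a b c)).
Proof.
move=> st; apply: (@reaches_loop _ _ _ _ (fun a => loop_state 4 [:: a]
  (acc + \sum_(0 <= a < a) \sum_(0 <= b < n) \sum_(0 <= c < n) Sd a b c))).
- move=> a [q z x an] bn [/= -> -> [z0 z1 z2] x0 x2].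
  rewrite addnC; mstep; rewrite z0 z2 leqNgt bn /=; mstep.
  rewrite -(addn2 tb); apply: reaches_trans.
    by apply: (@loop_b a); split; rewrite ?x2 //= z0 z1 z2.
  move=> [q' z' x' an'] [/= -> -> [z0' z1' z2'] x0' x2'].
  do 2!mstep; apply: reaches0; split=> //=; first by rewrite z0' z1' z2' addn1.
  by rewrite big_nat_recr //= addrA x2' x2.
- move=> [q z x an] [/= -> -> [z0 z1 z2] x0 x2].
  mstep; rewrite z0 z2 leqnn /=; apply: reaches0; split=> //=.
  by rewrite z0 z1.
- by rewrite big_geq // addr0.
Qed.

Lemma adj_queryE (i j : 'I_n) : adj_query G i j = G i j.
Proof. by rewrite /adj_query !valK. Qed.

Lemma trace_sum :
  \sum_(0 <= a < n) \sum_(0 <= b < n) \sum_(0 <= c < n) Sd a b c = tr4 (edge G) p.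
Proof.
rewrite /tr4 big_mkord; apply: eq_bigr => a _.
rewrite big_mkord; apply: eq_bigr => b _.
rewrite big_mkord; apply: eq_bigr => c _.
rewrite /Sd big_mkord; apply: eq_bigr => d _.
by rewrite /M !adj_queryE.
Qed.

Lemma trace_program_correct (eps : R) : (n0 < n)%N ->
  reaches P G (init n p eps) (60 * n ^ 4)
    (fun c => answer c = Some (tr4 (edge G) p <= 18 * n%:R ^+ 3)).
Proof.
move=> n0n.
have [m' mE] : exists m', (60 * n ^ 4 = 4 + (n * (tb + 4) + 1 + (8 + m')))%N.
  exists (60 * n ^ 4 - (4 + (n * (tb + 4) + 1 + 8)))%N.
  have := @nested_loop_bound n (leq_trans (ltn0Sn _) n0n).
  rewrite /tb /tc /td; clear; lia.
rewrite mE /init; mstep; mstep; rewrite leqNgt n0n /=; do 2!mstep.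
apply: reaches_trans.
  by apply: (@loop_a 0); split.
move=> [q z x an] [/= -> -> [z0 z1] x0 x2]; rewrite add0r trace_sum in x2.
do 7!mstep.
have -> : n%:R ^+ 3 = n%:R * n%:R * n%:R :> R by ring.
by rewrite z0 x2; case: ifP => _; mstep; apply: reaches0.
Qed.

End TraceProgram.

(** * The program that counts cliques exhaustively *)

Fixpoint pairs (V : Type) (s : seq V) : seq (V * V) :=
  if s is x :: s' then [seq (x, y) | y <- s'] ++ pairs s' else [::].

Lemma prod_pairs (R : realFieldType) (V : Type) (e : rel V) (s : seq V) :
  \prod_(q <- pairs s) (e q.1 q.2)%:R = (pairwise e s)%:R :> R.
Proof.
elim: s => [|x s IH] /=; first by rewrite big_nil.
rewrite big_cat /= IH big_map -mulnb natrM; congr (_ * _).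
by elim: s {IH} => [|y s IH]; rewrite ?big_nil ?big_cons //= IH -natrM mulnb.
Qed.

(* x_2 accumulates the clique count, x_3 is the running product. *)
Definition pair_code (q : nat * nat) : program :=
  [:: IConst 1 q.1; IConst 2 q.2; IAdj 3 1 2; ROfInt 4 3; RMul 3 3 4].

Definition word_code (s : seq nat) : program :=
  [:: IConst 1 1; ROfInt 3 1] ++ flatten (map pair_code (pairs s)) ++ [:: RAdd 2 2 3].

(* Since [IAdj] reads false outside the matrix, the same code counts the
   k-cliques of every graph on n <= N vertices, provided 1 < k. *)
Definition count_code (N k : nat) : program :=
  flatten (map word_code (words (iota 0 N) k)).

(** Truncated subtraction gives 0 for i >= n, in agreement with the falling factorial for k > n. *)
Definition factor_code (i : nat) : program :=
  [:: IConst 1 i; ISub 2 0 1; ROfInt 4 2; RMul 3 3 4].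

Definition expectation_code (k : nat) : program :=
  [:: IConst 1 1; ROfInt 3 1] ++ flatten (map factor_code (iota 0 k)) ++
  nseq 'C(k, 2) (RMul 3 3 0).

(** Leaves rho - 1 in x_3 and 1 - rho in x_4, so that the absolute value is tested by two
    comparisons with eps. *)
Definition deviation_code : program :=
  [:: RDiv 2 2 3; IConst 1 1; ROfInt 4 1; RSub 3 2 4; RSub 4 4 2].

Definition ratio_code (N k : nat) : program :=
  count_code N k ++ expectation_code k ++ deviation_code.

(** Jump targets are absolute, hence the start address [q]. *)
Definition compare_code (q : nat) : program :=
  [:: RJumpLe 3 1 q.+2; Halt false; RJumpLe 4 1 q.+4; Halt false; Halt true].

Definition clique_program (N k : nat) : program :=
  trace_code N ++ ratio_code N k ++ compare_code (44 + size (ratio_code N k)).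

Lemma all_flatten (T : Type) (a : pred T) (ss : seq (seq T)) :
  all a (flatten ss) = all (all a) ss.
Proof. by elim: ss => //= s ss IH; rewrite all_cat IH. Qed.

Lemma straight_ratio_code N k : all straight (ratio_code N k).
Proof.
rewrite /ratio_code /count_code /expectation_code !all_cat /= andbT.
rewrite !all_flatten !all_map all_nseq orbT andbT; apply/andP; split.
  apply/allP => s _; rewrite /= all_cat all_flatten all_map /= andbT.
  by apply/allP.
by apply/allP.
Qed.

Lemma no_flip_clique_program N k : all no_flip (clique_program N k).
Proof.
rewrite /clique_program all_cat /= all_cat /= andbT.
by apply: sub_all (straight_ratio_code N k); case.
Qed.

Section RatioProgram.
Variables (R : realType) (n : nat) (G : graph n) (p eps : R).

Definition ratio_state (acc prod : R) (c : config R) : Prop :=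
  [/\ ireg c 0 = n, rreg c 0 = p, rreg c 1 = eps, rreg c 2 = acc & rreg c 3 = prod].

Local Notation execs := (foldl (exec G false)).

Lemma exec_pairs l acc prod c : ratio_state acc prod c ->
  ratio_state acc (prod * \prod_(q <- l) (adj_query G q.1 q.2)%:R)
    (execs c (flatten (map pair_code l))).
Proof.
elim: l prod c => [|q l IH] prod c st; first by rewrite big_nil mulr1.
rewrite map_cons /= big_cons mulrA; apply: IH.
by case: c st => [q' z x an] [/= z0 x0 x1 x2 x3]; split; rewrite /upd //= x3.
Qed.

(** The final content of x_3 is left open, because the next word resets it to 1. *)
Lemma exec_word s acc prod c : ratio_state acc prod c ->
  exists prod', ratio_state (acc + (pairwise (adj_query G) s)%:R) prod'
    (execs c (word_code s)).
Proof.
move=> st; rewrite /word_code !foldl_cat.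
have /(exec_pairs (pairs s)) : ratio_state acc 1 (execs c [:: IConst 1 1; ROfInt 3 1]).
  by case: c st => [q' z x an] [/= z0 x0 x1 x2 x3]; split.
rewrite prod_pairs mul1r; set c' := execs _ _ => st'.
exists (pairwise (adj_query G) s)%:R.
by case: c' st' => [q' z x an] [/= z0 x0 x1 x2 x3]; split; rewrite /upd //= x2 x3.
Qed.

Lemma exec_count N k acc prod c : ratio_state acc prod c ->
  exists prod', ratio_state
    (acc + \sum_(s <- words (iota 0 N) k) (pairwise (adj_query G) s)%:R) prod'
    (execs c (count_code N k)).
Proof.
rewrite /count_code; elim: (words _ _) acc prod c => [|s l IH] acc prod c st.
  by exists prod; rewrite big_nil addr0.
have [prod' st'] := exec_word s st.
by rewrite big_cons addrA /= foldl_cat; apply: IH st'.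
Qed.

Lemma exec_expectation k acc prod c : ratio_state acc prod c ->
  ratio_state acc ((n ^_ k)%:R * p ^+ 'C(k, 2)) (execs c (expectation_code k)).
Proof.
move=> st; rewrite /expectation_code !foldl_cat.
have {st} : ratio_state acc 1 (execs c [:: IConst 1 1; ROfInt 3 1]).
  by case: c st => [q' z x an] [/= z0 x0 x1 x2 x3]; split.
set c' := execs _ _ => st.
have {st} : ratio_state acc (n ^_ k)%:R (execs c' (flatten (map factor_code (iota 0 k)))).
  elim: k => [//|k IH].
  rewrite -[in iota _ _]addn1 iotaD map_cat flatten_cat foldl_cat ffactnSr natrM /=.
  case: (execs c' _) IH => [q' z x an] [/= z0 x0 x1 x2 x3].
  by split; rewrite /upd //= x3 z0.
set c2 := execs _ _; elim: 'C(k, 2) c2 (_%:R) => [|m IH] c2 pr st /=.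
  by rewrite mulr1.
rewrite exprS mulrA; apply: IH.
by case: c2 st => [q' z x an] [/= z0 x0 x1 x2 x3]; split; rewrite /upd //= x3 x0.
Qed.

(** In a word of length at least 2 every letter takes part in a query. If all queries succeed, all
    letters are below n, so the other words contribute 0. *)
Lemma sum_cliques_query N k : (1 < k)%N -> (n <= N)%N ->
  \sum_(s <- words (iota 0 N) k) (pairwise (adj_query G) s)%:R = cliques R (edge G) k.
Proof.
move=> k1 nN; have adjq a b : adj_query G a b -> (a < n)%N && (b < n)%N.
  by rewrite /adj_query; case: insubP => // i ai _; case: insubP => // j bj _; rewrite ai bj.
rewrite (@sum_words_filter _ _ _ (fun a => a < n)%N); last first.
  move=> s sk; apply: contraNeq; rewrite pnatr_eq0 eqb0 negbK.
  case: s sk => [|x [|y s]]; try by move=> sk; rewrite -sk in k1.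
  move=> _ /=; rewrite -andbA => /and3P[/adjq/andP[-> ->] /allP xs _] /=.
  by apply/allP => z /xs /adjq /andP[].
have -> : [seq a <- iota 0 N | (a < n)%N] = map val (enum 'I_n).
  rewrite val_enum_ord -(subnKC nN) iotaD filter_cat -[RHS]cats0; congr (_ ++ _).
    by apply/all_filterP/allP => a; rewrite mem_iota => /andP[].
  rewrite -[RHS](filter_pred0 (iota (0 + n) (N - n))); apply: eq_in_filter => a.
  by rewrite mem_iota => /andP[na _]; rewrite ltnNge na.
rewrite words_map big_map /cliques; apply: eq_bigr => s _; congr _%:R.
rewrite pairwise_map; congr nat_of_bool; apply: eq_pairwise => i j /=.
by rewrite adj_queryE.
Qed.

Lemma compare_correct (P : program) (r : R) q z x :
  (forall i, onth P (q + i) = onth (compare_code q) i) ->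
  x 1%N = eps -> x 3%N = r - 1 -> x 4%N = 1 - r ->
  reaches P G (Config q z x None) 3 (fun c => answer c = Some (`|r - 1| <= eps)).
Proof.
move=> onthP x1 x3 x4.
have o0 := onthP 0%N; have o1 := onthP 1%N; have o2 := onthP 2%N.
have o3 := onthP 3%N; have o4 := onthP 4%N; rewrite !addnS !addn0 /= in o0 o1 o2 o3 o4.
have -> : (`|r - 1| <= eps) = (r - 1 <= eps) && (1 - r <= eps).
  by rewrite ler_norml lerNl opprB andbC.
apply: reachesS; rewrite /dstep /step /= o0 /= x3 x1.
case: (r - 1 <= eps); apply: reachesS; rewrite /dstep /step /= ?o1 ?o2 /=; last first.
  exact: reaches0.
rewrite x4 x1; case: (1 - r <= eps); apply: reachesS; rewrite /dstep /step /= ?o3 ?o4 /=;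
exact: reaches0.
Qed.

Lemma clique_program_small N k : (1 < k)%N -> (n <= N)%N ->
  reaches (clique_program N k) G (init n p eps) (size (ratio_code N k) + 5)
    (fun c => answer c =
       Some (`|cliques R (edge G) k / ((n ^_ k)%:R * p ^+ 'C(k, 2)) - 1| <= eps)).
Proof.
move=> k1 nN; set L := size _.
(* Two steps select the branch, L run the straight-line code and 3 suffice for the comparison. *)
have -> : (L + 5 = (L + 3).+2)%N by rewrite !addnS.
mstep; mstep; rewrite nN; set c0 := Config _ _ _ _.
have st0 : ratio_state 0 0 c0 by split.
have [prod st1] := exec_count N k st0.
have := exec_expectation k st1; rewrite add0r sum_cliques_query //.
set rho := _ / _; set cnt := cliques _ _ _; set ex := _ * _.
rewrite -!foldl_cat => st2.
have [it qE aE] : [/\ iter L (dstep (clique_program N k) G) c0 = execs c0 (ratio_code N k),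
   pc (execs c0 (ratio_code N k)) = (44 + L)%N & answer (execs c0 (ratio_code N k)) = None].
  by apply: (@run_straight R _ n G (trace_code N) _ (compare_code (44 + L)) c0) => //;
     exact: straight_ratio_code.
apply: (@reaches_trans _ _ _ _ _ _ _ (fun c => [/\ pc c = (44 + L)%N, answer c = None,
   rreg c 1 = eps, rreg c 3 = rho - 1 & rreg c 4 = 1 - rho])).
  exists L; rewrite // it; split=> //; rewrite /ratio_code catA foldl_cat;
  by case: (execs c0 _) st2 => [q z x an] [/= z0 x0 x1 x2 x3]; rewrite /upd /= ?x1 ?x2 ?x3.
move=> [q z x an] [/= -> -> x1 x3 x4].
have onthP i : onth (clique_program N k) (44 + L + i) = onth (compare_code (44 + L)) i.
  rewrite /clique_program !onth_cat -addnA ltnNge leq_addr /= addKn.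
  by rewrite ltnNge leq_addr addKn.
by apply: (@compare_correct _ rho (44 + L)).
Qed.

End RatioProgram.

(** * Assembly of the quality control algorithm *)

(** If the answer ignores the coins, every coin probability is 0 or 1. *)
Lemma quality_control_deterministic (R : realType) (X : finType) (D rho : X -> R)
    (eps : R) (T : nat) (A : X -> T.-tuple bool -> option bool) (dec : pred X) :
  (forall x r, A x r = Some (dec x)) ->
  2%:R / 3%:R <= \sum_(x | dec x) D x ->
  (forall x, dec x -> `|rho x - 1| <= eps) ->
  quality_control D rho eps A.
Proof.
move=> Adec acc snd.
have cp x b : coin_prob R (fun r => A x r == Some b) = (dec x == b)%:R.
  rewrite /coin_prob; case: (dec x =P b) => [db|/eqP db].
    rewrite (_ : [set r | _] = setT); last by apply/setP => r; rewrite !inE Adec db eqxx.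
    by rewrite cardsT card_tuple card_bool natrX divff // expf_neq0 // pnatr_eq0.
  rewrite (_ : [set r | _] = set0) ?cards0 ?mul0r //.
  apply/setP => r; rewrite !inE Adec; apply/eqP => -[E].
  by rewrite E eqxx in db.
split=> [|x xbad].
  rewrite big_mkcond in acc; apply: le_trans acc _; apply: ler_sum => x _.
  by rewrite cp; case: (dec x); rewrite ?mulr1 ?mulr0.
rewrite cp; case: (boolP (dec x)) => [/snd|_]; first by rewrite leNgt xbad.
by rewrite eqxx ler_pdivrMr ?ltr0n // mul1r ler_nat.
Qed.

Lemma rho_cliqueE (R : realType) n k (p : R) (G : graph n) :
  rho_clique k p G = cliques R (edge G) k / ((n ^_ k)%:R * p ^+ 'C(k, 2)).
Proof. by rewrite /rho_clique nb_cliquesE expected_cliquesE. Qed.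

(** Every graph has one empty word and n words of one letter as cliques, so for k < 2 accepting
    blindly is correct. *)
Lemma rho_clique_small (R : realType) n k (p : R) (G : graph n) :
  (0 < n)%N -> (k < 2)%N -> rho_clique k p G = 1.
Proof.
move=> n0 k2; rewrite rho_cliqueE bin_small // expr0 mulr1.
case: k k2 => [|[|//]] _; first by rewrite /cliques sum_words0 divr1.
rewrite cliquesS sum_words0 mul1r -natr_sum sum1_card card_ord ffactn1 divff //.
by rewrite pnatr_eq0 -lt0n.
Qed.

Lemma powR_threshold (R : realType) (p : R) n k : 0 < p ->
  p `^ (- (12%:R * k%:R)) <= n%:R ->
  (0 < n)%N /\ 1 <= n%:R * p ^+ (12 * k).
Proof.
move=> p0; rewrite powRN -natrM powR_mulrn ?(ltW p0) // => h.
have q0 : 0 < p ^+ (12 * k) by rewrite exprn_gt0.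
have n0 : 0 < n%:R :> R by apply: lt_le_trans h; rewrite invr_gt0.
by split; [rewrite ltr0n in n0 | rewrite -ler_pdivrMr // div1r].
Qed.

Theorem theorem1p3 (R : realType) :
  exists c4 c5 : R, 0 < c4 /\ 0 < c5 /\
  forall (k : nat) (eps : R), 0 < eps ->
  exists (A : program) (T : nat -> nat) (K : R),
    (forall n : nat, (0 < n)%N -> (T n)%:R <= K * n%:R `^ c4) /\
    forall (n : nat) (p : R), 0 < p -> p <= 1 ->
      p `^ (- (c5 * k%:R)) <= n%:R ->
      qc_admissible (@gnp R n p) (@rho_clique R n k p) eps ->
      halts_within A n p eps (T n) /\
      quality_control (@gnp R n p) (@rho_clique R n k p) eps
        (fun (G : graph n) (r : (T n).-tuple bool) => run A p eps G r).
Proof.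
exists 4%:R, 12%:R; do 2!(split; first by rewrite ltr0n); move=> k eps eps0.
have [k2|k2] := ltnP k 2.
  exists [:: Halt true], (fun=> 1%N), 1; split=> [n n0|n p p0 p1 np _].
    by rewrite mul1r powR_mulrn // exprn_ege1 // ler1n.
  have [n0 _] := powR_threshold p0 np.
  have runE (G : graph n) (r : 1.-tuple bool) :
      run [:: Halt true] p eps G r = Some (predT G).
    by case: r => -[|b []].
  split; first by move=> G r; rewrite runE.
  apply: quality_control_deterministic runE _ _ => [|G _].
    by rewrite gnp_total ler_pdivrMr ?ltr0n // mul1r ler_nat.
  by rewrite rho_clique_small // subrr normr0 ltW.
have [N close] := clique_ratio_close_eventually k eps0.
(* The exhaustive branch has length independent of n, as [N] is fixed by k and eps, so it enters the
   constant factor. *)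
pose C := (60 + (size (ratio_code N k) + 5))%N.
exists (clique_program N k), (fun n => C * n ^ 4)%N, C%:R.
split=> [n n0|n p p0 p1 np adm].
  by rewrite powR_mulrn // natrM natrX.
have [n0 np1] := powR_threshold p0 np.
pose dec (G : graph n) : bool := if (n <= N)%N then `|rho_clique k p G - 1| <= eps
  else tr4 (edge G) p <= 18 * n%:R ^+ 3.
have runE (G : graph n) (r : (C * n ^ 4).-tuple bool) :
    run (clique_program N k) p eps G r = Some (dec G).
  rewrite /run foldl_step ?no_flip_clique_program // size_tuple /dec rho_cliqueE.
  case: leqP => nN; last first.
    by apply: reaches_answer (trace_program_correct _ _ _ _ nN); rewrite leq_mul // leq_addr.
  apply: reaches_answer (clique_program_small _ _ _ k2 nN).
  by rewrite -[leqLHS]muln1 leq_mul ?leq_addl // expn_gt0 n0.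
split; first by move=> G r; rewrite runE.
apply: quality_control_deterministic runE _ _.
  (* Up to the threshold the decision is exact and admissibility gives 9/10; beyond it Markov's
     inequality gives 2/3. *)
  rewrite /dec; case: (n <= N)%N; last exact: tr4_typical (ltW p0) p1 n0.
  by apply: le_trans adm; lra.
move=> G; rewrite /dec; case: leqP => // nN tr; rewrite rho_cliqueE.
have := close 'I_n (edge G) p; rewrite card_ord; apply=> //.
exact: graph_sym.
Qed.
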